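(* Let $d\ge 2$ and $m$ be integers with $Z(d)\le m<2d$. Then $f_{\triangle}(d,m)=dm+\lfloor d/2\rfloor$.
   Context: All graphs are finite, simple and undirected. A graph is triangle-free if it has no three pairwise adjacent vertices. $\Delta(G)$ is the maximum degree and $\nu(G)$ the matching number of $G$. For positive integers $d,m$, $f_{\triangle}(d,m)$ is the maximum number of edges of a triangle-free graph $G$ with $\Delta(G)\le d$ and $\nu(G)\le m$. A graph $G$ is factor-critical if $G-v$ has a perfect matching for every vertex $v$. A graph is almost $d$-regular if one vertex has degree $d-1$ and all other vertices have degree $d$. For $d\ge 2$, $Z(d)$ is the smallest positive integer $n$ such that there exists a triangle-free factor-critical graph $G$ with $\nu(G)=n$ that is $d$-regular (if $d$ is even) or almost $d$-regular (if $d$ is odd). *)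

(* Defs.v *)
From mathcomp Require Import all_boot.

Set Implicit Arguments.
Unset Strict Implicit.
Unset Printing Implicit Defensive.

Record sgraph : Type := SGraph {
  vertex :> finType;
  adj : rel vertex;
  adj_sym : symmetric adj;
  adj_irr : irreflexive adj
}.

Section Graph.
Variable G : sgraph.

Definition edges : {set {set G}} :=
  [set [set p.1; p.2] | p : G * G & adj p.1 p.2].

Definition degree (v : G) : nat := #|[set w | adj v w]|.

Definition max_degree : nat := \max_(v : G) degree v.

Definition matching (M : {set {set G}}) : bool :=
  (M \subset edges) && trivIset M.

Definition matching_number : nat := \max_(M | matching M) #|M|.

Definition perfect_matching (M : {set {set G}}) : bool :=
  matching M && (cover M == [set: G]).

Definition triangle_free : Prop :=
  forall x y z : G, ~ [/\ adj x y, adj y z & adj x z].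

Definition regular (d : nat) : Prop := forall v : G, degree v = d.

(* Only used for [d >= 2], so the truncated predecessor is harmless. *)
Definition almost_regular (d : nat) : Prop :=
  exists2 v : G, degree v = d.-1 & forall w : G, w != v -> degree w = d.

End Graph.

Section Delete.
Variables (G : sgraph) (v : G).

Definition del_adj : rel {x : G | x != v} := fun x y => adj (val x) (val y).

Lemma del_adj_sym : symmetric del_adj.
Proof. by move=> x y; apply: adj_sym. Qed.

Lemma del_adj_irr : irreflexive del_adj.
Proof. by move=> x; apply: adj_irr. Qed.

Definition del_vertex : sgraph := SGraph del_adj_sym del_adj_irr.

End Delete.

Definition factor_critical (G : sgraph) : Prop :=
  forall v : G, exists M : {set {set del_vertex v}}, perfect_matching M.

Definition is_maximum (P : nat -> Prop) (n : nat) : Prop :=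
  P n /\ forall k, P k -> k <= n.

Definition is_minimum (P : nat -> Prop) (n : nat) : Prop :=
  P n /\ forall k, P k -> n <= k.

(* [is_f_triangle d m N] means that the maximum f_triangle(d, m) exists and
   equals [N]. *)
Definition is_f_triangle (d m : nat) : nat -> Prop :=
  is_maximum (fun N => exists G : sgraph,
    [/\ triangle_free G, max_degree G <= d, matching_number G <= m
      & #|edges G| = N]).

(* [is_Z d z] means that the minimum Z(d) exists and equals [z]. *)
Definition is_Z (d : nat) : nat -> Prop :=
  is_minimum (fun n => 0 < n /\ exists G : sgraph,
    [/\ triangle_free G, factor_critical G, matching_number G = n
      & if odd d then almost_regular G d else regular G d]).

(* Main.v *)
(** Upper bound: if some vertex lies in every maximum matching, deleting its at
    most [d] edges lowers the matching number by one.  Otherwise, by Gallai's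
    lemma, "no maximum matching misses both ends" is an equivalence relation
    containing adjacency; its classes have odd sizes [2k + 1], where the [k] sum
    to the matching number.  A class spans at most [d k + d/2] edges, and by
    Mantel at most [d k] when [k < d]; as [m < 2d], at most one class has
    [k >= d].  Lower bound: add [m - z] disjoint stars [K_{1,d}] to a graph
    witnessing [Z(d) = z], which has [2z + 1] vertices. *)

Require Import Defs.
From mathcomp Require Import all_boot.
From mathcomp Require Import zify.

Set Implicit Arguments.
Unset Strict Implicit.
Unset Printing Implicit Defensive.

(* [lia] compares atoms up to conversion, which diverges on cardinals and sums
   over finite types, so these are abstracted first. *)
Ltac abstract_atoms :=
  repeat match goal with
  | |- context [@card.body ?T ?A] => generalize (@card.body T A); intro
  | |- context [matching_number ?G] => generalize (matching_number G); intro
  | |- context [@degree ?G ?v] => generalize (@degree G v); intro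
  | |- context [bigop ?a ?b ?c] => generalize (bigop a b c); intro
  end.
Ltac card_lia := abstract_atoms; clear; lia.
Ltac card_nia := abstract_atoms; clear; nia.

(** * Edges, degrees and matchings *)

Section Edges.
Variable G : sgraph.
Implicit Types (u v w x y : G) (e f : {set G}) (M N : {set {set G}}).

Lemma edgesP e : reflect (exists x y, adj x y /\ e = [set x; y]) (e \in edges G).
Proof.
apply: (iffP imsetP) => [[[x y]]|[x [y [xy ->]]]].
  by rewrite inE /= => xy ->; exists x, y.
by exists (x, y); rewrite ?inE.
Qed.

Lemma mem_edges x y : adj x y -> [set x; y] \in edges G.
Proof. by move=> xy; apply/edgesP; exists x, y. Qed.

Lemma adj_neq x y : adj x y -> x != y.
Proof. by apply: contraTneq => ->; rewrite adj_irr. Qed.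

Lemma card_edge e : e \in edges G -> #|e| = 2.
Proof. by case/edgesP=> x [y [xy ->]]; rewrite cards2 adj_neq. Qed.

Lemma edge_incidentP e v :
  e \in edges G -> v \in e -> exists2 w, adj v w & e = [set v; w].
Proof.
case/edgesP=> x [y [xy ->]]; rewrite !inE => /orP[] /eqP->; first by exists y.
by exists x; rewrite 1?adj_sym // setUC.
Qed.

Lemma degree_edges v : degree v = #|[set e in edges G | v \in e]|.
Proof.
have -> : [set e in edges G | v \in e] = [set [set v; w] | w in [set w | adj v w]].
  apply/setP=> e; rewrite !inE; apply/andP/imsetP => [[eG ve]|[w]].
    by have [w vw ->] := edge_incidentP eG ve; exists w; rewrite ?inE.
  by rewrite inE => vw ->; rewrite mem_edges // !inE eqxx.
rewrite card_in_imset // => a b; rewrite !inE => va vb /setP/(_ a).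
rewrite !inE eqxx orbT => /esym/orP[/eqP av|/eqP //].
by rewrite av adj_irr in va.
Qed.

Lemma handshake : \sum_(v : G) degree v = 2 * #|edges G|.
Proof.
rewrite (eq_bigr (fun v => \sum_(e in edges G) (v \in e))); last first.
  move=> v _; rewrite degree_edges -sum1_card big_mkcond [RHS]big_mkcond /=.
  by apply: eq_bigr => e _; rewrite !inE; case: (_ \in edges G); case: (v \in e).
rewrite exchange_big /= mulnC -sum_nat_const; apply: eq_bigr => e eG.
by rewrite -(card_edge eG) -sum1_card [RHS]big_mkcond.
Qed.

Lemma degree_le_max v : degree v <= max_degree G.
Proof. exact: leq_bigmax. Qed.

Lemma matching0 : matching (set0 : {set {set G}}).
Proof. by rewrite /matching sub0set; apply/trivIsetP => A B; rewrite inE. Qed.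

Lemma matching_sub M N : N \subset M -> matching M -> matching N.
Proof.
move=> NM /andP[ME MT]; apply/andP; split; first exact: subset_trans ME.
exact: trivIsetS MT.
Qed.

Lemma matching_inj M e f x :
  matching M -> e \in M -> f \in M -> x \in e -> x \in f -> e = f.
Proof.
case/andP=> _ /trivIsetP tM eM fM xe xf; apply/eqP; apply: contraT => ef.
by have /disjointFr/(_ xe) := tM _ _ eM fM ef; rewrite xf.
Qed.

Lemma mem_coverP M x : reflect (exists2 e, e \in M & x \in e) (x \in cover M).
Proof. exact: bigcupP. Qed.

Lemma cover_incidentP M v :
  matching M -> v \in cover M -> exists2 w, adj v w & [set v; w] \in M.
Proof.
case/andP=> /subsetP ME _ /mem_coverP[e eM ve].
by have [w vw ew] := edge_incidentP (ME _ eM) ve; exists w => //; rewrite -ew.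
Qed.

Lemma matching_edge M e : matching M -> e \in M -> e \in edges G.
Proof. by case/andP=> /subsetP ME _ /ME. Qed.

Lemma card_cover_matching M : matching M -> #|cover M| = 2 * #|M|.
Proof.
move=> mM; have /andP[_ tM] := mM; rewrite -(eqP tM) mulnC -sum_nat_const.
by apply: eq_bigr => e /(matching_edge mM)/card_edge.
Qed.

Lemma leq_matching_number M : matching M -> #|M| <= matching_number G.
Proof. exact: leq_bigmax_cond. Qed.

Lemma matching_add M x y : matching M -> adj x y ->
  x \notin cover M -> y \notin cover M ->
  matching ([set x; y] |: M) /\ #|[set x; y] |: M| = #|M|.+1.
Proof.
move=> mM xy xM yM; have /andP[ME tM] := mM.
have nM : set0 \notin M.
  by apply/negP => /(matching_edge mM)/card_edge; rewrite cards0.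
have dis : {in M, forall B : {set G}, [disjoint [set x; y] & B]}.
  move=> B BM; rewrite disjoint_subset; apply/subsetP => t; rewrite !inE.
  by case/orP=> /eqP->; [apply: contra xM|apply: contra yM] => tB;
     apply/mem_coverP; exists B.
have [tU eM] := trivIsetU1 dis tM nM.
by rewrite cardsU1 eM /matching tU subUset sub1set mem_edges // ME.
Qed.

Definition max_matching M := matching M && (#|M| == matching_number G).

Lemma max_matching_exists : exists M, max_matching M.
Proof.
have [|M mM eM] := @eq_bigmax_cond _ (@matching G) (fun M => #|M|).
  by apply/card_gt0P; exists set0; exact: matching0.
exists M; apply/andP; split; first exact: mM.
by rewrite -eM /matching_number; apply/eqP/eq_bigl.
Qed.

(** Otherwise [M] could be enlarged by the edge [[set x; y]]. *)
Lemma max_matching_adj M x y :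
  max_matching M -> adj x y -> x \notin cover M -> y \in cover M.
Proof.
case/andP=> mM /eqP nM xy xM; apply: contraT => yM.
have [mM' cM'] := matching_add mM xy xM yM.
by have := leq_matching_number mM'; rewrite cM' nM ltnn.
Qed.

End Edges.

(** * Gallai's lemma and the resulting partition of the vertices *)

Section Gallai.
Variable G : sgraph.
Implicit Types (u v w x y : G) (e f : {set G}) (M N : {set {set G}}).

Definition never_both_missed u v :=
  [forall M : {set {set G}}, max_matching M ==> (u \in cover M) || (v \in cover M)].

Lemma never_both_missedP u v :
  reflect (forall M, max_matching M -> u \notin cover M -> v \in cover M)
          (never_both_missed u v).
Proof.
apply: (iffP forallP) => [H M mM uM|H M].
  by have /implyP/(_ mM) := H M; rewrite (negPf uM).
by apply/implyP => mM; case: (boolP (u \in cover M)) => //= uM; apply: H.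
Qed.

(** The disjunct [u == v] supplies reflexivity: a vertex missed by some maximum matching is not in
    [never_both_missed] with itself. *)
Definition gallai_rel u v := (u == v) || never_both_missed u v.

Lemma never_both_missed_sym : symmetric never_both_missed.
Proof. by move=> u v; apply: eq_forallb => M; rewrite orbC. Qed.

Lemma gallai_rel_sym : symmetric gallai_rel.
Proof. by move=> u v; rewrite /gallai_rel eq_sym never_both_missed_sym. Qed.

Lemma adj_gallai_rel u v : adj u v -> gallai_rel u v.
Proof.
move=> uv; apply/orP; right; apply/never_both_missedP => M mM.
exact: max_matching_adj.
Qed.

Hypothesis avoidable : forall v, exists2 M, max_matching M & v \notin cover M.

(* Among the maximum matchings missing [w], the one sharing most edges with
   [M] could be improved by swapping one of its edges for an edge of [M]. *)
Lemma never_both_missed_trans u w v : u != v ->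
  never_both_missed w u -> never_both_missed w v -> never_both_missed u v.
Proof.
move=> uv wu wv; apply/never_both_missedP => M maxM uM; apply: contraT => vM.
have [N0 maxN0 wN0] := avoidable w.
have PN0 : max_matching N0 && (w \notin cover N0) by rewrite maxN0.
have [N /andP[maxN wN] Nbest] :=
  @arg_maxnP _ N0 (fun N => max_matching N && (w \notin cover N))
    (fun N => #|M :&: N|) PN0.
have uN := never_both_missedP _ _ wu _ maxN wN.
have vN := never_both_missedP _ _ wv _ maxN wN.
have [mM /eqP cM] := andP maxM; have [mN /eqP cN] := andP maxN.
(* [M] and [N] cover equally many vertices, and [N] covers both [u] and [v], which [M] misses. So
   [M] covers at least two vertices missed by [N], one of which, [y], differs from [w]. *)
have card_eq : #|cover M :\: cover N| = #|cover N :\: cover M|.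
  have := cardsID (cover N) (cover M); have := cardsID (cover M) (cover N).
  by rewrite !card_cover_matching // cM cN setIC; card_lia.
have card_ge : 1 < #|cover N :\: cover M|.
  have <- : #|[set u; v]| = 2 by rewrite cards2 uv.
  apply/subset_leq_card/subsetP => t; rewrite !inE.
  by case/orP=> /eqP->; apply/andP.
have [y] : exists y, y \in (cover M :\: cover N) :\ w.
  apply/set0Pn; rewrite -card_gt0.
  move: card_ge; rewrite -card_eq (cardsD1 w (cover M :\: cover N)).
  by case: (w \in _); card_lia.
rewrite !inE => /and3P[yw yN yM].
have [z yz yzM] := cover_incidentP mM yM.
have zN := max_matching_adj maxN yz yN.
have [f fN zf] := mem_coverP _ _ zN.
(* If [f] were in [M], it would be the [M]-edge at [z], which contains [y], so [N] would cover
   [y]. *)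
have fM : f \notin M.
  apply/negP => fM; case/negP: yN; apply/mem_coverP; exists f => //.
  rewrite -(matching_inj mM yzM fM _ zf) ?inE ?eqxx ?orbT //.
have subN : N :\ f \subset N by apply: subsetDl.
have mN1 := matching_sub subN mN.
have cov1 t : t \notin cover N -> t \notin cover (N :\ f).
  apply: contra => /mem_coverP[e]; rewrite inE => /andP[_ eN] te.
  by apply/mem_coverP; exists e.
have zN1 : z \notin cover (N :\ f).
  apply/negP => /mem_coverP[e]; rewrite !inE => /andP[/eqP ef eN] ze.
  by apply: ef; apply: matching_inj mN eN fN ze zf.
have [mN' cN'] := matching_add mN1 yz (cov1 _ yN) zN1.
(* Trading [f] for [[set y; z]] keeps the size and still misses [w]: [y] was chosen different from
   [w], and [z] is covered by [N] while [w] is not. *)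
have PN' : max_matching ([set y; z] |: (N :\ f)) &&
           (w \notin cover ([set y; z] |: (N :\ f))).
  rewrite /max_matching mN' cN' -cN (cardsD1 f N) fN eqxx /=.
  apply/negP => /mem_coverP[e]; rewrite inE => /orP[/set1P->|eN we].
    rewrite !inE eq_sym (negPf yw) /= => /eqP wz.
    by rewrite wz zN in wN.
  by case/negP: (cov1 _ wN); apply/mem_coverP; exists e.
have /= := Nbest _ PN'; rewrite leqNgt => /negP[]; apply: proper_card.
apply/properP; split.
  apply/subsetP => e; rewrite !inE => /andP[eM eN]; rewrite eM eN /=.
  by rewrite andbT; apply/orP; right; apply: contraNneq fM => <-.
exists [set y; z]; first by rewrite !inE yzM eqxx.
rewrite !inE yzM /=; apply: contra yN => yzN.
by apply/mem_coverP; exists [set y; z] => //; rewrite !inE eqxx.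
Qed.

Lemma gallai_rel_trans : transitive gallai_rel.
Proof.
move=> w u v /orP[/eqP->//|uw] /orP[/eqP<-|wv]; first by rewrite /gallai_rel uw orbT.
rewrite /gallai_rel; case: eqVneq => //= uv; apply: never_both_missed_trans wv => //.
by rewrite never_both_missed_sym.
Qed.

Definition gallai_classes := equivalence_partition gallai_rel [set: G].

Lemma gallai_equiv : {in [set: G] & &, equivalence_rel gallai_rel}.
Proof.
move=> x y z _ _ _; split; first by rewrite /gallai_rel eqxx.
move=> xy; apply/idP/idP; last exact: gallai_rel_trans.
by apply: gallai_rel_trans; rewrite gallai_rel_sym.
Qed.

Lemma gallai_classes_partition : partition gallai_classes [set: G].
Proof. exact/equivalence_partitionP/gallai_equiv. Qed.

Lemma gallai_class_mem C x y :
  C \in gallai_classes -> x \in C -> (y \in C) = gallai_rel x y.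
Proof.
move=> CP xC; have /and3P[_ tP _] := gallai_classes_partition.
rewrite -(def_pblock tP CP xC).
by rewrite pblock_equivalence_partition ?inE //; apply: gallai_equiv.
Qed.

Lemma gallai_class_adj C x y :
  C \in gallai_classes -> x \in C -> adj x y -> y \in C.
Proof. by move=> CP xC /adj_gallai_rel; rewrite (gallai_class_mem _ CP xC). Qed.

(** Adjacent vertices share a class, so every edge of [M] meeting [C] lies inside [C]. *)
Lemma even_gallai_class_cover C M :
  C \in gallai_classes -> matching M -> ~~ odd #|C :&: cover M|.
Proof.
move=> CP mM; have sub : [set e in M | e \subset C] \subset M.
  by apply/subsetP => e; rewrite inE => /andP[].
suff -> : C :&: cover M = cover [set e in M | e \subset C].
  by rewrite (card_cover_matching (matching_sub sub mM)) mul2n odd_double.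
apply/setP => x; rewrite inE; apply/andP/mem_coverP => [[xC xM]|[e]].
  have [y xy xyM] := cover_incidentP mM xM.
  exists [set x; y]; last by rewrite !inE eqxx.
  rewrite inE xyM; apply/subsetP => t; rewrite !inE => /orP[] /eqP-> //.
  exact: gallai_class_adj xy.
rewrite inE => /andP[eM /subsetP eC] xe; split; first exact: eC.
by apply/mem_coverP; exists e.
Qed.

Lemma gallai_class_missed C M :
  C \in gallai_classes -> max_matching M -> #|C :\: cover M| <= 1.
Proof.
move=> CP mM; apply/card_le1P => x; rewrite inE => /andP[xM xC] y.
rewrite !inE; apply/andP/eqP => [[yM yC]|->//].
move: yC; rewrite (gallai_class_mem _ CP xC) => /orP[/eqP//|].
by move/never_both_missedP/(_ _ mM xM); rewrite (negPf yM).
Qed.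

(** A maximum matching missing a vertex of [C] misses only that one in [C], and it covers an even
    number of vertices of [C]. *)
Lemma odd_gallai_class C : C \in gallai_classes -> odd #|C|.
Proof.
move=> CP; have /and3P[_ _ P0] := gallai_classes_partition.
have /set0Pn[x xC] : C != set0 by apply: contraNneq P0 => <-.
have [M maxM xM] := avoidable x; have [mM _] := andP maxM.
have := gallai_class_missed CP maxM; have := even_gallai_class_cover CP mM.
have : 0 < #|C :\: cover M| by apply/card_gt0P; exists x; rewrite inE xM.
by rewrite -(cardsID (cover M) C); card_lia.
Qed.

(** A maximum matching misses at most one vertex of each class; by parity it misses exactly one, so
    it covers [2 * (#|C| %/ 2)] vertices of [C]. *)
Lemma sum_gallai_classes :
  \sum_(C in gallai_classes) #|C| %/ 2 = matching_number G.
Proof.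
have [M maxM] := max_matching_exists G; have [mM /eqP cM] := andP maxM.
apply/eqP; rewrite -(eqn_pmul2l (isT : 0 < 2)) -cM -card_cover_matching //.
rewrite big_distrr /= (eq_bigr (fun C : {set G} => \sum_(x in C) (x \in cover M : nat))).
  rewrite -(set_partition_big _ gallai_classes_partition) /=.
  by rewrite -sum1_card [X in _ == X]big_mkcond; apply/eqP/eq_big => x; rewrite ?inE.
move=> C CP; have := gallai_class_missed CP maxM.
have := even_gallai_class_cover CP mM; have := odd_gallai_class CP.
have -> : \sum_(x in C) (x \in cover M) = #|C :&: cover M|.
  rewrite -sum1_card big_mkcond [RHS]big_mkcond; apply: eq_bigr => x _.
  by rewrite inE; case: (x \in C); case: (x \in cover M).
by rewrite -(cardsID (cover M) C); card_lia.
Qed.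

End Gallai.

(** * Degree sums over sets closed under adjacency *)

(* Mantel's argument: the neighbourhood of a vertex of maximum degree is
   independent, so its complement meets every edge. *)
Lemma mantel_closed (G : sgraph) (C : {set G}) (d : nat) :
  triangle_free G -> max_degree G <= d ->
  (forall x y, x \in C -> adj x y -> y \in C) ->
  exists2 D, D <= d & \sum_(x in C) degree x <= 2 * ((#|C| - D) * D).
Proof.
move=> tf Dd clC; have [->|/set0Pn[x0 x0C]] := eqVneq C set0.
  by exists 0; rewrite // big_set0.
have [x xC xmax] := @arg_maxnP _ x0 (mem C) (@degree G) x0C.
exists (degree x); first exact: leq_trans (degree_le_max x) Dd.
pose A := [set y | adj x y].
have AC : A \subset C by apply/subsetP => y; rewrite inE; apply: clC.
(* [A] is independent, so every edge at a vertex of [A] has its other end in [C :\: A]; these edges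
   are counted from both ends. *)
have sumA : \sum_(y in A) degree y <= \sum_(y in C :\: A) degree y.
  have degE (v : G) (P : pred G) : \sum_(w | P w) (adj v w : nat)
      = #|[set w | P w & adj v w]|.
    rewrite -sum1_card big_mkcond [RHS]big_mkcond; apply: eq_bigr => w _.
    by rewrite inE; case: (P w); case: (adj v w).
  apply: (@leq_trans (\sum_(y in A) \sum_(w in C :\: A) adj y w)).
    apply: leq_sum => y; rewrite inE => xy; rewrite degE.
    apply/subset_leq_card/subsetP => w; rewrite !inE => yw.
    have wC : w \in C := clC _ _ (clC _ _ xC xy) yw.
    rewrite wC yw !andbT; apply/negP => xw.
    exact: (tf x y w).
  rewrite exchange_big /=; apply: leq_sum => w _.
  rewrite (eq_bigr (fun y : G => adj w y : nat)) => [|y _]; last by rewrite adj_sym.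
  by rewrite degE; apply/subset_leq_card/subsetP => y; rewrite !inE => /andP[].
rewrite (big_setID A) /= (setIidPr AC).
have : \sum_(y in C :\: A) degree y <= (#|C| - degree x) * degree x.
  have -> : #|C| - degree x = #|C :\: A|.
    by have := cardsID A C; rewrite (setIidPr AC) /degree -/A; card_lia.
  rewrite -sum_nat_const; apply: leq_sum => y; rewrite inE => /andP[_].
  exact: xmax.
by move: sumA; card_lia.
Qed.

(** Two numbers with odd sum [2k + 1] have the largest product when they differ by one; for larger
    [D] the truncated difference is zero. *)
Lemma mul_complement_leq k D : ((2 * k).+1 - D) * D <= k * k.+1.
Proof.
have [Dk|kD] := leqP D k.
  by rewrite -(subnKC Dk); move: (k - D) => j; nia.
by rewrite -(subnKC kD); move: (D - k.+1) => j; nia.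
Qed.

(** Let [#|C| = 2k + 1]. If [d <= k], bounding each degree by [d] gives [2dk + d]. If [k < d],
    Mantel gives [2k(k + 1) <= 2dk]. The boolean factor marks the first case. *)
Lemma odd_closed_degree_sum (G : sgraph) (C : {set G}) (d : nat) :
  triangle_free G -> max_degree G <= d ->
  (forall x y, x \in C -> adj x y -> y \in C) -> odd #|C| ->
  \sum_(x in C) degree x <= 2 * d * (#|C| %/ 2) + d * (d <= #|C| %/ 2).
Proof.
move=> tf Dd clC oC; case: (leqP d (#|C| %/ 2)) => dk.
  apply: (@leq_trans (#|C| * d)); last by move: oC; card_nia.
  rewrite -sum_nat_const; apply: leq_sum => x _.
  exact: leq_trans (degree_le_max x) Dd.
have [D DleD /leq_trans] := mantel_closed tf Dd clC; apply.
have -> : #|C| = (2 * (#|C| %/ 2)).+1 by move: oC; card_lia.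
have := mul_complement_leq (#|C| %/ 2) D.
rewrite [(2 * (_ %/ 2)).+1 %/ 2](_ : _ = #|C| %/ 2); last by card_lia.
by move: dk; generalize (#|C| %/ 2); clear; nia.
Qed.

Lemma gallai_edge_bound (G : sgraph) (d : nat) :
  triangle_free G -> max_degree G <= d -> matching_number G < 2 * d ->
  (forall v : G, exists2 M, max_matching M & v \notin cover M) ->
  2 * #|edges G| <= 2 * d * matching_number G + d.
Proof.
move=> tf Dd nu av; rewrite -handshake.
have -> : \sum_(v : G) degree v = \sum_(v in [set: G]) degree v.
  by apply: eq_bigl => v; rewrite inE.
rewrite (set_partition_big _ (gallai_classes_partition av)) /=.
apply: (@leq_trans (\sum_(C in gallai_classes G)
    (2 * d * (#|C| %/ 2) + d * (d <= #|C| %/ 2)))).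
  apply: leq_sum => C CP; apply: odd_closed_degree_sum => //.
    by move=> x y; apply: gallai_class_adj.
  exact: odd_gallai_class.
rewrite big_split /= -!big_distrr /= sum_gallai_classes //.
rewrite leq_add2l; set s := \sum_(_ in _) _.
(* [s] counts the classes with [d <= #|C| %/ 2]. Each contributes at least [d] to the matching
   number, which is below [2d], so [s <= 1]. *)
have : d * s <= matching_number G.
  rewrite -(sum_gallai_classes av) big_distrr /=; apply: leq_sum => C _.
  by case: (leqP d (#|C| %/ 2)); card_lia.
move=> /leq_ltn_trans/(_ nu); rewrite mulnC ltn_mul2r => /andP[_ s1].
by rewrite -[X in _ <= X]mul1n leq_mul2r -ltnS s1 orbT.
Qed.

(** * Isolating a vertex, and the upper bound *)

Definition isolate_adj (G : sgraph) (v : G) : rel G :=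
  fun x y => [&& x != v, y != v & adj x y].

Lemma isolate_adj_sym (G : sgraph) (v : G) : symmetric (isolate_adj v).
Proof. by move=> x y; rewrite /isolate_adj adj_sym andbCA. Qed.

Lemma isolate_adj_irr (G : sgraph) (v : G) : irreflexive (isolate_adj v).
Proof. by move=> x; rewrite /isolate_adj adj_irr !andbF. Qed.

(** Keeping [v] as an isolated vertex preserves the vertex type, so edges and matchings of both
    graphs are sets of the same type. *)
Definition isolate (G : sgraph) (v : G) : sgraph :=
  SGraph (@isolate_adj_sym G v) (@isolate_adj_irr G v).

Lemma edges_isolate (G : sgraph) (v : G) :
  edges (isolate v) = [set e in edges G | v \notin e] :> {set {set G}}.
Proof.
apply/setP => e; rewrite inE; apply/(edgesP (e : {set isolate v}))/andP.
  move=> [x [y [/and3P[xv yv xy] ->]]]; split; first exact: mem_edges.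
  by rewrite !inE !(eq_sym v) negb_or; apply/andP.
case=> /edgesP[x [y [xy ->]]]; rewrite !inE !(eq_sym v) negb_or => /andP[xv yv].
by exists x, y; split => //; apply/and3P.
Qed.

Lemma card_edges_isolate (G : sgraph) (v : G) :
  #|edges G| = #|edges (isolate v)| + degree v.
Proof.
rewrite edges_isolate degree_edges addnC.
rewrite -(cardsID [set e : {set G} | v \in e] (edges G)); congr (_ + _).
  by apply: eq_card => e; rewrite !inE.
by apply: eq_card => e; rewrite !inE andbC.
Qed.

Lemma max_degree_isolate (G : sgraph) (v : G) :
  max_degree (isolate v) <= max_degree G.
Proof.
apply/bigmax_leqP => x _; apply: leq_trans (degree_le_max (x : G)).
by apply/subset_leq_card/subsetP => y; rewrite !inE => /and3P[].
Qed.

Lemma triangle_free_isolate (G : sgraph) (v : G) :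
  triangle_free G -> triangle_free (isolate v).
Proof.
by move=> tf x y z [/and3P[_ _ a] /and3P[_ _ b] /and3P[_ _ c]]; apply: (tf x y z).
Qed.

Lemma matching_isolate (G : sgraph) (v : G) (M : {set {set G}}) :
  matching (M : {set {set isolate v}}) -> matching M /\ v \notin cover M.
Proof.
case/andP; rewrite edges_isolate => /subsetP ME tM; split.
  apply/andP; split => //; apply/subsetP => e /ME; by rewrite inE => /andP[].
by apply/negP => /mem_coverP[e /ME]; rewrite inE => /andP[_ /negP].
Qed.

(** Induction on the matching number; the bound is doubled to avoid the floor of [d/2]. *)
Lemma edge_bound (G : sgraph) (d : nat) :
  triangle_free G -> max_degree G <= d -> matching_number G < 2 * d ->
  2 * #|edges G| <= 2 * d * matching_number G + d.
Proof.
have [n] := ubnP (matching_number G); elim: n G => // n IH G ltn tf Dd nu.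
have [|] := boolP [forall v : G, exists M, max_matching M && (v \notin cover M)].
  move/forallP=> av; apply: gallai_edge_bound => // v.
  by have /existsP[M /andP[? ?]] := av v; exists M.
rewrite negb_forall => /existsP[v]; rewrite negb_exists => /forallP cov.
(* A maximum matching of [isolate v] is a matching of [G] missing [v], whereas every maximum
   matching of [G] covers [v]. *)
have lt : matching_number (isolate v) < matching_number G.
  have [M /andP[mM /eqP <-]] := max_matching_exists (isolate v).
  have [mM' vM] := matching_isolate mM.
  rewrite ltn_neqAle (leq_matching_number mM') andbT.
  by have := cov M; rewrite vM andbT /max_matching mM'.
have := IH (isolate v); rewrite (card_edges_isolate v).
have := leq_trans (max_degree_isolate v) Dd; have := degree_le_max v.
move=> dv Di /(_ _ (triangle_free_isolate tf) Di) H.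
have {H} := H (leq_trans lt ltn) (ltn_trans lt nu).
by move: lt dv Dd; rewrite /max_degree; card_nia.
Qed.

(** * Adding disjoint stars *)

Lemma sum_option (I : finType) (F : option I -> nat) :
  \sum_a F a = F None + \sum_i F (Some i).
Proof.
rewrite (bigD1 None) //=; congr (_ + _).
rewrite (reindex_omap Some id) => [|[] //].
by apply: eq_bigl => i; rewrite eqxx.
Qed.

Section AddStars.
Variables (G : sgraph) (k d : nat).

(* In the [i]-th star, [(i, None)] is the center. *)
Definition stars_adj : rel (G + 'I_k * option 'I_d) := fun x y =>
  match x, y with
  | inl u, inl v => adj u v
  | inr (i, a), inr (j, b) => (i == j) && ((a == None) != (b == None))
  | _, _ => false
  end.

Lemma stars_adj_sym : symmetric stars_adj.
Proof.
move=> [u|[i a]] [v|[j b]] //=; first exact: adj_sym.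
by rewrite eq_sym (eq_sym (a == None)).
Qed.

Lemma stars_adj_irr : irreflexive stars_adj.
Proof. by move=> [u|[i a]] /=; rewrite ?adj_irr // [X in ~~ X]eqxx andbF. Qed.

Definition add_stars : sgraph := SGraph stars_adj_sym stars_adj_irr.

Lemma triangle_free_add_stars : triangle_free G -> triangle_free add_stars.
Proof.
move=> tf [x|[i a]] [y|[j b]] [t|[l c]] [] //=; first by move=> ? ? ?; apply: (tf x y t).
by case: a => [a|]; case: b => [b|]; case: c => [c|] /=; rewrite ?andbF.
Qed.

Lemma degree_add_stars_inl (v : G) : degree (inl v : add_stars) = degree v.
Proof.
have inj : injective (inl : G -> add_stars) by move=> a b [].
rewrite /degree -[RHS](card_imset _ inj).
apply: eq_card => -[w|p]; rewrite !inE /=.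
  by rewrite mem_imset ?inE.
by apply/esym/negP => /imsetP[].
Qed.

Lemma degree_add_stars_center i : degree (inr (i, None) : add_stars) = d.
Proof.
have inj : injective (fun a : 'I_d => inr (i, Some a) : add_stars) by move=> a b [].
rewrite -[RHS]card_ord -cardsT /degree -[RHS](card_imset _ inj).
apply: eq_card => -[w|[j [b|]]]; rewrite !inE /=.
- by apply/esym/negP => /imsetP[].
- rewrite andbT; apply/eqP/imsetP => [->|[a _ [-> _]] //].
  by exists b.
- by rewrite andbF; apply/esym/negP => /imsetP[].
Qed.

Lemma degree_add_stars_leaf i a : degree (inr (i, Some a) : add_stars) = 1.
Proof.
rewrite /degree -[RHS](cards1 (inr (i, None) : add_stars)).
apply: eq_card => -[w|[j [b|]]]; rewrite !inE /=.
- by apply/esym/eqP.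
- by rewrite andbF; apply/esym/eqP.
- by rewrite andbT; apply/eqP/eqP => [->|[]].
Qed.

Lemma max_degree_add_stars :
  0 < d -> max_degree G <= d -> max_degree add_stars <= d.
Proof.
move=> d0 Gd; apply/bigmax_leqP => -[v|[i [a|]]] _.
- by rewrite degree_add_stars_inl; apply: leq_trans (degree_le_max v) Gd.
- by rewrite degree_add_stars_leaf.
- by rewrite degree_add_stars_center.
Qed.

Lemma big_sum_stars (w : add_stars -> nat) :
  \sum_x w x = \sum_(v : G) w (inl v) +
    \sum_(i < k) (w (inr (i, None)) + \sum_(a < d) w (inr (i, Some a))).
Proof.
rewrite big_sumType /=; congr (_ + _).
transitivity (\sum_(i < k) \sum_(a : option 'I_d) w (inr (i, a))).
  by rewrite pair_bigA; apply: eq_bigr => -[].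
by apply: eq_bigr => i _; rewrite sum_option.
Qed.

Lemma card_edges_add_stars : #|edges add_stars| = #|edges G| + k * d.
Proof.
apply/eqP; rewrite -(eqn_pmul2l (isT : 0 < 2)) mulnDr -!handshake.
rewrite big_sum_stars; apply/eqP; congr (_ + _).
  by apply: eq_bigr => v _; apply: degree_add_stars_inl.
rewrite (eq_bigr (fun=> 2 * d)).
  by rewrite sum_nat_const card_ord mulnCA.
move=> i _; rewrite degree_add_stars_center (eq_bigr (fun=> 1)).
  by rewrite sum1_card card_ord mul2n addnn.
by move=> a _; apply: degree_add_stars_leaf.
Qed.

(** Twice a fractional vertex cover: one half on [G], one on each center, zero on leaves. *)
Definition stars_weight (x : add_stars) : nat :=
  match x with inl _ => 1 | inr (_, a) => 2 * (a == None) end.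

(* Every edge has weight at least 2, so a matching has at most half as many
   edges as the total weight. *)
Lemma matching_number_add_stars z :
  #|G| <= (2 * z).+1 -> matching_number add_stars <= z + k.
Proof.
move=> Gz; apply/bigmax_leqP => M mM; have /andP[_ tM] := mM.
have : #|M| * 2 <= \sum_x stars_weight x.
  apply: (@leq_trans (\sum_(x in cover M) stars_weight x)).
    rewrite big_trivIset //= -sum_nat_const; apply: leq_sum => e eM.
    have /edgesP[x [y [xy ->]]] := matching_edge mM eM.
    have xNy : x \notin [set y] by rewrite in_set1 adj_neq.
    rewrite (big_setU1 _ xNy) big_set1.
    by case: x y xy {xNy} => [u|[i [a|]]] [v|[j [b|]]] //=; rewrite andbF.
  by rewrite big_mkcond; apply: leq_sum => x _; case: ifP.
have -> : \sum_x stars_weight x = #|G| + k * 2.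
  rewrite big_sum_stars; congr (_ + _); first exact: sum1_card.
  rewrite -[in RHS](card_ord k) -sum_nat_const; apply: eq_bigr => i _.
  by rewrite big1.
(* The total weight is at most [2(z + k) + 1], and halving discards the odd unit. *)
by move: Gz; card_lia.
Qed.

End AddStars.

(** * Factor-critical and almost regular graphs, and the conclusion *)

Lemma card_del_vertex (G : sgraph) (v : G) : #|G| = #|del_vertex v|.+1.
Proof.
have -> : #|del_vertex v| = #|[pred x : G | x != v]| by apply: card_sig.
by rewrite (cardD1 v) inE; congr (_.+1); apply: eq_card => x; rewrite !inE andbT.
Qed.

Lemma matching_number_del_vertex (G : sgraph) (v : G) (M : {set {set del_vertex v}}) :
  matching M -> #|M| <= matching_number G.
Proof.
move=> mM; have /andP[_ /trivIsetP tM] := mM.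
have vinj : injective (val : del_vertex v -> G) by apply: val_inj.
rewrite -(card_imset _ (imset_inj vinj)); apply: leq_matching_number.
apply/andP; split.
  apply/subsetP => _ /imsetP[e eM ->].
  have /edgesP[x [y [xy ->]]] := matching_edge mM eM.
  by rewrite imsetU1 imset_set1; apply: mem_edges.
apply/trivIsetP => _ _ /imsetP[e eM ->] /imsetP[f fM ->] ef.
rewrite imset_disjoint //.
by apply: tM => //; apply: contraNneq ef => ->.
Qed.

(** A perfect matching of [G - v] has [(#|G| - 1)/2] edges, while a maximum matching of [G] covers
    at most [#|G|] vertices. Positivity excludes the empty graph, which is vacuously
    factor-critical. *)
Lemma factor_critical_card (G : sgraph) : factor_critical G ->
  0 < matching_number G -> #|G| = (2 * matching_number G).+1.
Proof.
move=> fc nu0; have [M /andP[mM /eqP cM]] := max_matching_exists G.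
have cov := card_cover_matching mM; have := max_card (mem (cover M)).
have /card_gt0P[v _] : 0 < #|cover M| by rewrite cov cM muln_gt0.
rewrite cov cM (card_del_vertex v).
have [N /andP[mN /eqP cN]] := fc v.
have := card_cover_matching mN; rewrite cN cardsT.
by have := matching_number_del_vertex mN; card_lia.
Qed.

(** The degree sum is [d(2n + 1)], less one when [d] is odd; half of it is the edge count. *)
Lemma card_edges_regular (G : sgraph) (d n : nat) : 0 < d ->
  #|G| = (2 * n).+1 ->
  (if odd d then almost_regular G d else regular G d) ->
  max_degree G <= d /\ #|edges G| = d * n + d %/ 2.
Proof.
move=> d0 cG; have hs := handshake G; case: ifP => od.
  case=> v dv dw; split.
    apply/bigmax_leqP => x _; have [->|/dw->//] := eqVneq x v.
    by rewrite dv leq_pred.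
  move: hs; rewrite (bigD1 v) //= dv (eq_bigr (fun=> d)) //.
  rewrite sum_nat_const (eq_card (B := predC1 v)) // cardC1 cG /=.
  by rewrite -mulnA (mulnC n); move: od d0; generalize (d * n); card_lia.
move=> reg; split; first by apply/bigmax_leqP => x _; rewrite reg.
move: hs; rewrite (eq_bigr (fun=> d)) // sum_nat_const cG mulSn -mulnA (mulnC n).
by move: od; generalize (d * n); card_lia.
Qed.

Theorem theorem5 (d m z : nat) (hd : 2 <= d) (hz : is_Z d z)
    (hzm : z <= m) (hm : m < 2 * d) :
  is_f_triangle d m (d * m + d %/ 2).
Proof.
split; last first.
  move=> _ [G [tf Dd nu <-]].
  (* The doubled bound grows with the matching number, and integrality turns [d/2] into its
     floor. *)
  have := edge_bound tf Dd (leq_ltn_trans nu hm).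
  have := leq_mul (leqnn d) nu; rewrite -mulnA.
  by generalize (d * matching_number G) (d * m); card_lia.
have [[z0 [G [tf fc nuz reg]]] _] := hz; have d0 : 0 < d := ltnW hd.
have cG : #|G| = (2 * z).+1 by rewrite -nuz factor_critical_card // nuz.
have [Dd eG] := card_edges_regular d0 cG reg.
exists (add_stars G (m - z) d); split.
- exact: triangle_free_add_stars.
- exact: max_degree_add_stars.
- by rewrite -[X in _ <= X](subnKC hzm) matching_number_add_stars // cG.
- by rewrite card_edges_add_stars eG; move: hzm; clear; nia.
Qed.
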